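(* Let $\mathbb{F}$ be a division ring, $n$ a positive integer, $\sigma:\mathbb{F}\to\mathbb{F}^{n\times n}$ a ring morphism and $\delta:\mathbb{F}\to\mathbb{F}^n$ a $\sigma$-derivation. Let $\mathbf{a}_1,\dots,\mathbf{a}_\ell\in\mathbb{F}^n$ be pairwise non-conjugate and let $\mathcal{B}_i^{\mathcal{D}}=\{\beta_1^{(i)},\dots,\beta_{M_i}^{(i)}\}\subseteq\mathbb{F}^*$ for $i=1,\dots,\ell$. Write $\mathbf{a}=(\mathbf{a}_1,\dots,\mathbf{a}_\ell)$, $\mathcal{B}^{\mathcal{D}}=(\mathcal{B}_1^{\mathcal{D}},\dots,\mathcal{B}_\ell^{\mathcal{D}})$ and $M=M_1+\cdots+M_\ell$. Define $\mathcal{B}=\{\mathbf{b}_1,\mathbf{b}_2,\dots,\mathbf{b}_M\}\subseteq\mathbb{F}^n$ (listed in this order) by $$\mathbf{b}_r=\mathbf{a}_i^{\beta_j^{(i)}}=\mathcal{D}_{\mathbf{a}_i}(\beta_j^{(i)})(\beta_j^{(i)})^{-1},\qquad r=M_1+\cdots+M_{i-1}+j,$$ for $j=1,\dots,M_i$ and $i=1,\dots,\ell$. Let $\mathcal{N}$ be a finite set of monomials with $\mathcal{M}_{|\mathcal{B}|}\subseteq\mathcal{N}\subseteq\mathcal{M}$. Then $$\mathrm{Rk}(V^{\mathcal{D}}_{\mathcal{N}}(\mathbf{a},\mathcal{B}^{\mathcal{D}}))=\mathrm{Rk}(V_{\mathcal{N}}(\mathcal{B}))=\sum_{i=1}^\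ell\dim^R_{K_{\mathbf{a}_i}}\left(\left\langle\beta_1^{(i)},\beta_2^{(i)},\dots,\beta_{M_i}^{(i)}\right\rangle^R_{K_{\mathbf{a}_i}}\right).$$
   Context: Rings are associative with identity, not necessarily commutative, and ring morphisms preserve identities. $\mathbb{F}^*=\mathbb{F}\setminus\{0\}$ and $\mathbb{F}^n$ denotes column vectors. A map $\delta:\mathbb{F}\to\mathbb{F}^n$ is a $\sigma$-derivation if $\delta(a+b)=\delta(a)+\delta(b)$ and $\delta(ab)=\sigma(a)\delta(b)+\delta(a)b$ for all $a,b\in\mathbb{F}$. Free skew polynomial ring: let $\mathcal{M}$ be the free monoid on pairwise distinct variables $x_1,\dots,x_n$ (monomials); the degree of a monomial is its length, and $\mathcal{M}_d$ is the set of monomials of degree less than $d$. $\mathbb{F}[\mathbf{x};\sigma,\delta]$ is the left $\mathbb{F}$-vector space with basis $\mathcal{M}$, with the ring product given by concatenating monomials and $x_i a=\sum_{j=1}^n\sigma_{i,j}(a)x_j+\delta_i(a)$ for $a\in\mathbb{F}$. Skew evaluation: for $\mathbf{b}=(b_1,\dots,b_n)\in\mathbb{F}^n$, $F(\mathbf{b})$ is the unique element of $\mathbb{F}$ such that $F-F(\mathbf{b})$ belongs to the left ideal generated by $x_1-b_1,\dots,x_n-b_n$. For $\mathfrak{m}\in\mathcal{M}$, $N_{\mathfrak{m}}(\mathbf{b})\in\mathbb{F}$ denotes the skew evaluation of $\mathfrak{m}$ at $\mathbf{b}$. Linearized maps: $\mathcal{D}_{\mathbf{a}}(\beta)=\sigma(\beta)\mathbf{a}+\delta(\beta)\in\mathbb{F}^n$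 for $\mathbf{a}\in\mathbb{F}^n$, $\beta\in\mathbb{F}$. Maps $\mathcal{D}_{\mathbf{a}}^{\mathfrak{m}}:\mathbb{F}\to\mathbb{F}$ are defined recursively by $\mathcal{D}_{\mathbf{a}}^{1}=\mathrm{Id}$ and $\mathcal{D}_{\mathbf{a}}^{x_i\mathfrak{m}}(\beta)=$ the $i$-th component of $\mathcal{D}_{\mathbf{a}}(\mathcal{D}_{\mathbf{a}}^{\mathfrak{m}}(\beta))$. For $\beta\in\mathbb{F}^*$, $\mathbf{a}^\beta=\mathcal{D}_{\mathbf{a}}(\beta)\beta^{-1}$; two points $\mathbf{a},\mathbf{b}$ are conjugate if $\mathbf{b}=\mathbf{a}^\beta$ for some $\beta\in\mathbb{F}^*$ (an equivalence relation). $K_{\mathbf{a}}=\{\beta\in\mathbb{F}\mid\mathcal{D}_{\mathbf{a}}(\beta)=\mathbf{a}\beta\}$, a division subring of $\mathbb{F}$. $\langle\cdot\rangle^R_K$ and $\dim^R_K$ denote right $K$-span and right $K$-dimension. Vandermonde matrices: for a finite ordered set $\mathcal{N}\subseteq\mathcal{M}$, the skew Vandermonde matrix $V_{\mathcal{N}}(\mathcal{B})$ is the $|\mathcal{N}|\times M$ matrix with rows $(N_{\mathfrak{m}}(\mathbf{b}_1),\dots,N_{\mathfrak{m}}(\mathbf{b}_M))$, $\mathfrak{m}\in\mathcal{N}$. The linearized Vandermonde matrix $V^{\mathcal{D}}_{\mathcal{N}}(\mathbf{a},\mathcal{B}^{\mathcal{D}})$ is the $|\mathcal{N}|\times M$ matrix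 with rows $$\left(\mathcal{D}^{\mathfrak{m}}_{\mathbf{a}_1}(\beta_1^{(1)}),\dots,\mathcal{D}^{\mathfrak{m}}_{\mathbf{a}_1}(\beta_{M_1}^{(1)}),\dots,\mathcal{D}^{\mathfrak{m}}_{\mathbf{a}_\ell}(\beta_1^{(\ell)}),\dots,\mathcal{D}^{\mathfrak{m}}_{\mathbf{a}_\ell}(\beta_{M_\ell}^{(\ell)})\right),\quad\mathfrak{m}\in\mathcal{N}.$$ The rank $\mathrm{Rk}$ of a matrix over $\mathbb{F}$ is the usual rank over a division ring: the left $\mathbb{F}$-dimension of its row space, equivalently the right $\mathbb{F}$-dimension of its column space. *)

(* Defs.v *)
From HB Require Import structures.
From mathcomp Require Import all_boot all_order all_algebra.
From mathcomp Require Import finmap.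
From mathcomp Require Import boolp classical_sets.
From mathcomp.multinomials Require Import monalg.

Set Implicit Arguments.
Unset Strict Implicit.
Unset Printing Implicit Defensive.

Import Order.TTheory GRing.Theory.

Local Open Scope classical_set_scope.
Local Open Scope ring_scope.


Section Dimension.
Variables (R : nzRingType) (V : lmodType R) (K : {pred R}).

Definition lspan m (v : 'I_m -> V) : set V :=
  [set x | exists2 c : 'I_m -> R,
     (forall j, c j \in K) & x = \sum_j c j *: v j].

Definition lfree m (v : 'I_m -> V) : Prop :=
  forall c : 'I_m -> R, (forall j, c j \in K) ->
    \sum_j c j *: v j = 0 -> forall j, c j = 0.

Definition is_ldim (S : set V) (d : nat) : Prop :=
  exists2 e : 'I_d -> V, lfree e & lspan e = S.

(* 0 on sets without a finite basis.  When K is a division subring of R, every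
   lspan K v has a finite basis, and all its bases have size ldim K (lspan K v):
   see ldim_lspanP and ldimE. *)
Definition ldim (S : set V) : nat := xget 0%N (is_ldim S).

End Dimension.

Section DimensionTheory.
Variables (R : unitRingType) (V : lmodType R) (K : {pred R}).
Hypothesis KD : divring_closed K.
Hypothesis KU : forall x, x \in K -> x != 0 -> x \is a GRing.unit.

Let K0 : 0 \in K.
Proof. by case: KD => K1 KB _; rewrite -(subrr 1) KB. Qed.
Let K1 : 1 \in K. Proof. by case: KD. Qed.
Let KB x y : x \in K -> y \in K -> x - y \in K.
Proof. by case: KD => _ + _; apply. Qed.
Let KN x : x \in K -> - x \in K.
Proof. by move=> Kx; rewrite -sub0r KB. Qed.
Let KA x y : x \in K -> y \in K -> x + y \in K.
Proof. by move=> Kx Ky; rewrite -[y]opprK KB // KN. Qed.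
Let KV x : x \in K -> x^-1 \in K.
Proof. by case: KD => _ _ KV Kx; rewrite -[_^-1]mul1r KV. Qed.
Let KM x y : x \in K -> y \in K -> x * y \in K.
Proof. by case: KD => _ _ Kd Kx Ky; rewrite -[y]invrK Kd // KV. Qed.
Let Ksum (I : finType) (f : I -> R) :
  (forall i, f i \in K) -> \sum_i f i \in K.
Proof. by move=> Kf; elim/big_ind: _. Qed.

Lemma homogeneous_solution m d (A : 'I_d -> 'I_m -> R) :
  (m < d)%N -> (forall i j, A i j \in K) ->
  exists x : 'I_d -> R, [/\ forall i, x i \in K, exists i, x i != 0 &
    forall j, \sum_i x i * A i j = 0].
Proof.
elim: m d A => [|m IHm] [//|d] A ltmd KAij.
  exists (fun=> 1); split=> //; last by case.
  by exists ord0; rewrite oner_neq0.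
have [/existsP[i0 Ai0]|/existsPn A0] := boolP [exists i, A i ord0 != 0].
  pose t := (A i0 ord0)^-1.
  pose B (i : 'I_d) (j : 'I_m) := A (lift i0 i) (lift ord0 j)
    - A (lift i0 i) ord0 * t * A i0 (lift ord0 j).
  have KBij i j : B i j \in K by rewrite KB // !KM ?KV.
  have [x [Kx [i1 xi1] xB]] := IHm d B ltmd KBij.
  pose s := - \sum_i x i * A (lift i0 i) ord0 * t.
  have Ks : s \in K by rewrite KN // Ksum // => i; rewrite !KM ?KV.
  pose y i := if unlift i0 i is Some k then x k else s.
  have yl k : y (lift i0 k) = x k by rewrite /y liftK.
  have y0 : y i0 = s by rewrite /y unlift_none.
  have sumy f : \sum_i y i * f i = s * f i0 + \sum_i x i * f (lift i0 i).
    rewrite (bigD1_ord i0) //= y0; congr (_ + _).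
    by apply: eq_bigr => i _; rewrite yl.
  exists y; split=> [i||j]; first by rewrite /y; case: unlift.
    by exists (lift i0 i1); rewrite yl.
  rewrite sumy; have [k ->|->] := unliftP ord0 j.
    rewrite /s mulNr addrC mulr_suml -sumrB -[RHS](xB k).
    by apply: eq_bigr => i _; rewrite /B mulrBr !mulrA.
  rewrite /s mulNr mulr_suml addrC -sumrB big1 // => i _.
  by rewrite /t mulrVK ?subrr // KU.
have [|x [Kx x0 xA]] := IHm d.+1 (fun i j => A i (lift ord0 j)) (ltnW ltmd).
  by move=> i j.
exists x; split=> // j; have [k ->|->] := unliftP ord0 j; first exact: xA.
by rewrite big1 // => i _; have /negbNE/eqP-> := A0 i; rewrite mulr0.
Qed.

Lemma lfree_leq d m (e : 'I_d -> V) (v : 'I_m -> V) :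
  lfree K e -> (forall i, lspan K v (e i)) -> (d <= m)%N.
Proof.
move=> fe ev; rewrite leqNgt; apply/negP => ltmd.
have /choice[A AP] : forall i, exists c : 'I_m -> R,
    (forall j, c j \in K) /\ e i = \sum_j c j *: v j.
  by move=> i; have [c] := ev i; exists c.
have [|x [Kx [i xi] xA]] := @homogeneous_solution m d A ltmd.
  by move=> i j; case: (AP i).
case/eqP: xi; apply: (fe x Kx).
under eq_bigr => k _ do rewrite (AP k).2 scaler_sumr.
rewrite exchange_big big1 //= => j _.
under eq_bigr => k _ do rewrite scalerA.
by rewrite -scaler_suml xA scale0r.
Qed.

Lemma lspan_mem m (v : 'I_m -> V) i : lspan K v (v i).
Proof.
exists (fun j => (j == i)%:R) => [j|]; first by case: eqP.
rewrite (bigD1 i) //= eqxx scale1r big1 ?addr0 // => j /negPf->.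
by rewrite scale0r.
Qed.

Lemma is_ldim_uniq (S : set V) d d' : is_ldim K S d -> is_ldim K S d' -> d = d'.
Proof.
move=> [e fe <-] [e' fe' ee']; apply/eqP; rewrite eqn_leq.
rewrite (lfree_leq fe (v := e')) ?(lfree_leq fe' (v := e)) //= => i.
  by rewrite -ee'; exact: lspan_mem.
by rewrite ee'; exact: lspan_mem.
Qed.

Lemma ldimE (S : set V) d : is_ldim K S d -> ldim K S = d.
Proof.
move=> Sd; apply: (is_ldim_uniq _ Sd); exact: (@xgetI _ _ (is_ldim K S) d).
Qed.

Lemma is_ldim_lspan m (v : 'I_m -> V) : exists d, is_ldim K (lspan K v) d.
Proof.
elim: m v => [|m IHm] v; first by exists 0%N; exists v => // c _ _ [].
have [fv|] := pselect (lfree K v); first by exists m.+1; exists v.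
move=> /existsNP[c /not_implyP[Kc /not_implyP[cv0 /existsNP[i /eqP ci]]]].
have [d dP] := IHm (v \o lift i); exists d; congr (is_ldim _ _ _): dP.
have vi : v i = \sum_j (- ((c i)^-1 * c (lift i j))) *: v (lift i j).
  have Ui : c i \is a GRing.unit by rewrite KU.
  move: cv0; rewrite (bigD1_ord i) //= => /eqP; rewrite addr_eq0 => /eqP cvi.
  rewrite -[LHS]scale1r -(mulVr Ui) -scalerA cvi scalerN scaler_sumr -sumrN.
  by apply: eq_bigr => j _; rewrite scalerA scaleNr.
rewrite eqEsubset; split=> x [y Ky ->].
  exists (fun k => if unlift i k is Some j then y j else 0).
    by move=> k; case: unlift.
  rewrite (bigD1_ord i) //= unlift_none scale0r add0r.
  by apply: eq_bigr => j _; rewrite liftK.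
exists (fun j => y (lift i j) - y i * ((c i)^-1 * c (lift i j))).
  by move=> j; rewrite KB // !KM // KV.
rewrite (bigD1_ord i) //= vi scaler_sumr -big_split /=.
by apply: eq_bigr => j _; rewrite scalerA mulrN addrC scalerBl scaleNr.
Qed.

Lemma ldim_lspanP m (v : 'I_m -> V) : is_ldim K (lspan K v) (ldim K (lspan K v)).
Proof. by have [d dP] := is_ldim_lspan v; rewrite (ldimE dP). Qed.

End DimensionTheory.

(* In a left module over the converse ring F^c one has c *: x = x * c, so the
   left K-span and K-dimension there are the right ones in F. *)
Definition rspan (F : nzRingType) (K : {pred F}) m (v : 'I_m -> F) : set F :=
  @lspan F^c (F^c)^o K m v.

Definition rdim (F : nzRingType) (K : {pred F}) (S : set F) : nat :=
  @ldim F^c (F^c)^o K S.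

Lemma rspanE (F : nzRingType) (K : {pred F}) m (v : 'I_m -> F) :
  rspan K v = [set x | exists2 c : 'I_m -> F,
     (forall j, c j \in K) & x = \sum_j v j * c j].
Proof. by []. Qed.

(* The rank in mxalgebra requires a commutative field. *)
Definition mxrk (F : nzRingType) m n (A : 'M[F]_(m, n)) : nat :=
  ldim predT (lspan predT (fun i : 'I_m => row i A)).


Definition rscale_col (F : nzRingType) n (v : 'cV[F]_n) (c : F) : 'cV[F]_n :=
  \col_i (v i 0 * c).

Definition sigma_derivation (F : nzRingType) n (sigma : F -> 'M[F]_n)
    (delta : F -> 'cV[F]_n) : Prop :=
  (forall a b, delta (a + b) = delta a + delta b) /\
  (forall a b, delta (a * b) = sigma a *m delta b + rscale_col (delta a) b).

(* The free monoid on x_1, ..., x_n, with concatenation as product; the degree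
   is the size. *)
Notation monomial n := (seq 'I_n).

Definition skewpoly (F : nzRingType) n (sigma : {rmorphism F -> 'M[F]_n})
    (delta : F -> 'cV[F]_n) (hdelta : sigma_derivation sigma delta) : Type :=
  {malg F[monomial n]}.

Section SkewPolyRing.
Variables (F : nzRingType) (n : nat) (sigma : {rmorphism F -> 'M[F]_n}).
Variables (delta : F -> 'cV[F]_n) (hdelta : sigma_derivation sigma delta).

Local Notation T := (skewpoly hdelta).

HB.instance Definition _ := GRing.Lmodule.on T.

Definition skewmono (m : monomial n) : T := << 1 *g m >>.

Definition skewlin (V : lmodType F) (f : monomial n -> F -> V) (p : T) : V :=
  \sum_(m <- msupp p) f m p@_m.

(* x_i * p, by x_i * (a *: m) = \sum_j sigma_ij(a) *: (x_j m) + delta_i(a) *: m *)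
Definition skewXmul (i : 'I_n) : T -> T :=
  skewlin (fun m a =>
    \sum_j sigma a i j *: skewmono (j :: m) + delta a i 0 *: skewmono m).

Definition skewmonomul (m : monomial n) (p : T) : T := foldr skewXmul p m.

Definition skewmul (p q : T) : T :=
  skewlin (fun m a => a *: skewmonomul m q) p.

Lemma skewmonoE (p : T) : p = \sum_(m <- msupp p) p@_m *: skewmono m.
Proof.
rewrite {1}[p]monalgE; apply: eq_bigr => m _; apply/malgP => k.
by rewrite mcoeffZ !mcoeffU mulrnAr mulr1.
Qed.

Section SkewLin.
Variables (V : lmodType F) (f : monomial n -> F -> V).
Hypothesis fD : forall m, {morph f m : a b / a + b}.

Let f0 m : f m 0 = 0.
Proof. by apply: (addrI (f m 0)); rewrite -fD !addr0. Qed.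

Let skewlinEw (d : {fset monomial n}) (p : T) : (msupp p `<=` d)%fset ->
  skewlin f p = \sum_(m <- d) f m p@_m.
Proof.
move=> ppd; rewrite /skewlin (big_fset_incl _ ppd) // => m _ /mcoeff_outdom ->.
exact: f0.
Qed.

Lemma skewlinD (p q : T) : skewlin f (p + q) = skewlin f p + skewlin f q.
Proof.
pose d := (msupp p `|` msupp q)%fset.
rewrite (@skewlinEw d (p + q)) ?msuppD_le //.
rewrite (@skewlinEw d p) ?fsubsetUl // (@skewlinEw d q) ?fsubsetUr //.
by rewrite -big_split; apply: eq_bigr => m _; rewrite mcoeffD fD.
Qed.

Lemma skewlinZU a m : skewlin f (a *: skewmono m) = f m a.
Proof.
rewrite (@skewlinEw [fset m]%fset) ?big_seq_fset1.
  by rewrite mcoeffZ mcoeffUU mulr1.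
exact: fsubset_trans (msuppZ_le _ _) msuppU_le.
Qed.
End SkewLin.

Lemma skew_ind (P : T -> Prop) :
  P 0 -> (forall p q, P p -> P q -> P (p + q)) ->
  (forall a m, P (a *: skewmono m)) -> forall p, P p.
Proof. by move=> P0 PD Pm p; rewrite [p]skewmonoE; elim/big_ind: _. Qed.

Lemma sigmaD a b i j : sigma (a + b) i j = sigma a i j + sigma b i j.
Proof. by rewrite rmorphD mxE. Qed.

Lemma deltaD a b i : delta (a + b) i 0 = delta a i 0 + delta b i 0.
Proof. by case: hdelta => -> _; rewrite mxE. Qed.

Lemma sigmaM a b i j : sigma (a * b) i j = \sum_k sigma a i k * sigma b k j.
Proof. by rewrite rmorphM mxE. Qed.

Lemma deltaM a b i :
  delta (a * b) i 0 = \sum_k sigma a i k * delta b k 0 + delta a i 0 * b.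
Proof. by case: hdelta => _ ->; rewrite !mxE. Qed.

Lemma sigma1 i j : sigma 1 i j = (i == j)%:R.
Proof. by rewrite rmorph1 mxE. Qed.

Lemma delta1 i : delta 1 i 0 = 0.
Proof.
have := deltaM 1 1 i; rewrite mulr1 mulr1 (bigD1 i) //= sigma1 eqxx mul1r big1.
  by rewrite addr0 => /eqP; rewrite -subr_eq subrr eq_sym => /eqP.
by move=> k ki; rewrite sigma1 eq_sym (negPf ki) mul0r.
Qed.

Lemma skewXmulD i : {morph skewXmul i : p q / p + q}.
Proof.
apply: skewlinD => m a b; rewrite deltaD scalerDl addrACA.
by congr (_ + _); rewrite -big_split; apply: eq_bigr => j _; rewrite sigmaD scalerDl.
Qed.

Lemma skewXmulZU i a m : skewXmul i (a *: skewmono m) =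
  \sum_j sigma a i j *: skewmono (j :: m) + delta a i 0 *: skewmono m.
Proof.
rewrite /skewXmul skewlinZU // => {}m {}a b.
rewrite deltaD scalerDl addrACA.
by congr (_ + _); rewrite -big_split; apply: eq_bigr => j _; rewrite sigmaD scalerDl.
Qed.

Lemma skewXmul0 i : skewXmul i 0 = 0.
Proof. by apply: (addrI (skewXmul i 0)); rewrite -skewXmulD !addr0. Qed.

Lemma skewXmul_mono i m : skewXmul i (skewmono m) = skewmono (i :: m).
Proof.
rewrite -[skewmono m]scale1r skewXmulZU delta1 scale0r addr0.
rewrite (bigD1 i) //= sigma1 eqxx scale1r big1 ?addr0 // => j ji.
by rewrite sigma1 eq_sym (negPf ji) scale0r.
Qed.

Lemma skewXmulZ i a p :
  skewXmul i (a *: p) =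
    \sum_j sigma a i j *: skewXmul j p + delta a i 0 *: p.
Proof.
elim/skew_ind: p => [|p q IHp IHq|b m].
- rewrite !scaler0 skewXmul0 addr0 big1 // => j _.
  by rewrite skewXmul0 scaler0.
- rewrite scalerDr skewXmulD IHp IHq addrACA -scalerDr.
  by congr (_ + _); rewrite -big_split; apply: eq_bigr => j _; rewrite skewXmulD scalerDr.
rewrite scalerA skewXmulZU deltaM scalerDl addrA -scalerA; congr (_ + _).
under [RHS]eq_bigr => j _ do rewrite skewXmulZU scalerDr scaler_sumr scalerA.
rewrite big_split exchange_big /= scaler_suml; congr (_ + _).
apply: eq_bigr => j _; rewrite sigmaM scaler_suml.
by apply: eq_bigr => k _; rewrite scalerA.
Qed.

Lemma skewmonomulD m : {morph skewmonomul m : p q / p + q}.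
Proof. by elim: m => [//|i m IHm] p q /=; rewrite IHm skewXmulD. Qed.

Lemma skewmonomul_mono m m' : skewmonomul m (skewmono m') = skewmono (m ++ m').
Proof. by elim: m => [//|i m /= ->]; rewrite skewXmul_mono. Qed.

Lemma skewmulZU a m q : skewmul (a *: skewmono m) q = a *: skewmonomul m q.
Proof. by rewrite /skewmul skewlinZU // => {}m {}a b; rewrite scalerDl. Qed.

Lemma skewmulDl : left_distributive skewmul +%R.
Proof.
by move=> p q r; apply: skewlinD => m a b; rewrite scalerDl.
Qed.

Lemma skewmulDr : right_distributive skewmul +%R.
Proof.
move=> p q r; rewrite /skewmul /skewlin -big_split.
by apply: eq_bigr => m _; rewrite skewmonomulD scalerDr.
Qed.

Lemma skewmul0l q : skewmul 0 q = 0.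
Proof. by apply: (addrI (skewmul 0 q)); rewrite -skewmulDl !addr0. Qed.

Lemma skewmulZl a p q : skewmul (a *: p) q = a *: skewmul p q.
Proof.
elim/skew_ind: p => [|p p' IHp IHp'|b m]; first by rewrite scaler0 skewmul0l scaler0.
  by rewrite scalerDr !skewmulDl IHp IHp' scalerDr.
by rewrite scalerA !skewmulZU scalerA.
Qed.

Lemma skewXmulA i p q : skewmul (skewXmul i p) q = skewXmul i (skewmul p q).
Proof.
elim/skew_ind: p => [|p p' IHp IHp'|a m].
- by rewrite skewXmul0 skewmul0l skewXmul0.
- by rewrite skewXmulD !skewmulDl IHp IHp' skewXmulD.
rewrite skewXmulZU skewmulZU skewXmulZ skewmulDl skewmulZU; congr (_ + _).
rewrite (big_morph (skewmul^~ q) (fun _ _ => skewmulDl _ _ _) (skewmul0l q)).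
by apply: eq_bigr => j _; rewrite skewmulZU.
Qed.

Lemma skewmulA : associative skewmul.
Proof.
move=> p q r; elim/skew_ind: p => [|p p' IHp IHp'|a m].
- by rewrite !skewmul0l.
- by rewrite !skewmulDl IHp IHp'.
rewrite !skewmulZU skewmulZl; congr (_ *: _).
by elim: m => [//|i m /= ->]; rewrite skewXmulA.
Qed.

Lemma skewmul1l : left_id (skewmono [::]) skewmul.
Proof. by move=> p; rewrite -[skewmono _]scale1r skewmulZU scale1r. Qed.

Lemma skewmul1r : right_id (skewmono [::]) skewmul.
Proof.
move=> p; elim/skew_ind: p => [|p p' IHp IHp'|a m]; first exact: skewmul0l.
  by rewrite skewmulDl IHp IHp'.
by rewrite skewmulZU skewmonomul_mono cats0.
Qed.

Lemma skew1_neq0 : skewmono [::] != 0.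
Proof. by rewrite monalgU_eq0 oner_neq0. Qed.

HB.instance Definition _ := GRing.Zmodule_isNzRing.Build T
  skewmulA skewmul1l skewmul1r skewmulDl skewmulDr skew1_neq0.

HB.instance Definition _ := GRing.Lmodule_isLalgebra.Build F T
  (fun a p q => esym (skewmulZl a p q)).

Definition skewX (i : 'I_n) : T := skewmono [:: i].

Lemma skewmono_nil : skewmono [::] = 1.
Proof. by []. Qed.

Lemma skewmonoM m m' : skewmono m * skewmono m' = skewmono (m ++ m').
Proof.
rewrite -[skewmono m]scale1r -[LHS]/(skewmul _ _) skewmulZU.
by rewrite skewmonomul_mono scale1r.
Qed.

Lemma skewXM i p : skewX i * p = skewXmul i p.
Proof.
by rewrite -[skewX i]scale1r -[LHS]/(skewmul _ _) skewmulZU scale1r.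
Qed.

Lemma skewXC i a :
  skewX i * a%:A = \sum_j sigma a i j *: skewX j + (delta a i 0)%:A.
Proof. by rewrite skewXM skewXmulZU. Qed.
End SkewPolyRing.

Section Evaluation.
Variables (F : nzRingType) (n : nat) (sigma : {rmorphism F -> 'M[F]_n}).
Variables (delta : F -> 'cV[F]_n) (hdelta : sigma_derivation sigma delta).

Local Notation T := (skewpoly hdelta).

Definition left_ideal_gen (R : nzRingType) m (g : 'I_m -> R) : set R :=
  [set p | exists q : 'I_m -> R, p = \sum_i q i * g i].

Definition point_ideal (b : 'cV[F]_n) : set T :=
  left_ideal_gen (fun i => skewX hdelta i - (b i 0)%:A).

(* The choice is made among exactly one value, by [skew_evalP] and
   [skew_evalE]. *)
Definition skew_eval (b : 'cV[F]_n) (p : T) : F :=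
  xget 0 [set c | point_ideal b (p - c%:A)].

Let point_idealD b p q :
  point_ideal b p -> point_ideal b q -> point_ideal b (p + q).
Proof.
move=> [p' ->] [q' ->]; exists (fun i => p' i + q' i).
by rewrite -big_split; apply: eq_bigr => i _; rewrite mulrDl.
Qed.

Let point_idealM b r p : point_ideal b p -> point_ideal b (r * p).
Proof.
move=> [p' ->]; exists (fun i => r * p' i).
by rewrite mulr_sumr; apply: eq_bigr => i _; rewrite mulrA.
Qed.

Let point_ideal0 b : point_ideal b 0.
Proof. by exists (fun=> 0); rewrite big1 // => i _; rewrite mul0r. Qed.

Let point_idealX b i : point_ideal b (skewX hdelta i - (b i 0)%:A).
Proof.
exists (fun j => (j == i)%:R); rewrite (bigD1 i) //= eqxx mul1r.
by rewrite big1 ?addr0 // => j /negPf->; rewrite mul0r.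
Qed.

Let point_idealZ b a p : point_ideal b p -> point_ideal b (a *: p).
Proof. by move=> bp; rewrite -[p]mul1r scalerAl; exact: point_idealM. Qed.

Let scaleDA (a c : F) : (a + c)%:A = a%:A + c%:A :> T.
Proof. exact: scalerDl. Qed.

Lemma skew_eval_ex b (p : T) : exists c, point_ideal b (p - c%:A).
Proof.
elim/skew_ind: p => [|p q [c pc] [d qd]|a m].
- by exists 0; rewrite scale0r subr0; exact: point_ideal0.
- by exists (c + d); rewrite scaleDA opprD addrACA; exact: point_idealD.
suff [c mc] : exists c, point_ideal b (skewmono hdelta m - c%:A).
  exists (a * c); rewrite -scalerA -scalerBr; exact: point_idealZ.
elim: m => [|i m [c mc]].
  by exists 1; rewrite scale1r subrr; exact: point_ideal0.
exists (\sum_j sigma c i j * b j 0 + delta c i 0).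
have -> : skewmono hdelta (i :: m) =
    skewX hdelta i * (skewmono hdelta m - c%:A) + skewX hdelta i * c%:A.
  by rewrite -mulrDr subrK skewmonoM.
rewrite skewXC scaleDA opprD -addrA; apply: point_idealD.
  exact: point_idealM.
rewrite addrACA subrr addr0 scaler_suml -sumrB.
elim/big_ind: _ => [|p q|j _]; [exact: point_ideal0|exact: point_idealD|].
by rewrite -scalerA -scalerBr; apply: point_idealZ; exact: point_idealX.
Qed.

(* F is a left module over the skew polynomial ring, with x_i acting by
   c |-> (sigma(c) b + delta(c))_i; the generators of the ideal kill 1. *)
Let Xact (b : 'cV[F]_n) (i : 'I_n) (c : F) : F := \sum_j sigma c i j * b j 0 + delta c i 0.
Let act (b : 'cV[F]_n) (p : T) (c : F) : F :=
  skewlin (fun m a => (a * foldr (Xact b) c m : F^o)) p.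

Let XactD b i : {morph Xact b i : c d / c + d}.
Proof.
move=> c d; rewrite /Xact (deltaD hdelta) addrACA.
by congr (_ + _); rewrite -big_split; apply: eq_bigr => j _; rewrite sigmaD mulrDl.
Qed.

Let XactM b i a c :
  Xact b i (a * c) = \sum_j sigma a i j * Xact b j c + delta a i 0 * c.
Proof.
rewrite /Xact (deltaM hdelta) addrA; congr (_ + _).
under [RHS]eq_bigr => j _ do rewrite mulrDr mulr_sumr.
rewrite big_split exchange_big /=; congr (_ + _).
apply: eq_bigr => j _; rewrite sigmaM mulr_suml.
by apply: eq_bigr => k _; rewrite mulrA.
Qed.

Let actDl b p q c : act b (p + q) c = act b p c + act b q c.
Proof. by rewrite /act skewlinD // => m x y; rewrite mulrDl. Qed.

Let actU b a m c : act b (a *: skewmono hdelta m) c = a * foldr (Xact b) c m.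
Proof. by rewrite /act skewlinZU // => {}m x y; rewrite mulrDl. Qed.

Let act0l b c : act b 0 c = 0.
Proof. by apply: (addrI (act b 0 c)); rewrite -actDl !addr0. Qed.

Let foldXD b m : {morph (fun c => foldr (Xact b) c m) : c d / c + d}.
Proof. by elim: m => [//|i m IHm] c d /=; rewrite IHm XactD. Qed.

Let actDr b p : {morph act b p : c d / c + d}.
Proof.
move=> c d; rewrite /act /skewlin -big_split.
by apply: eq_bigr => m _; rewrite foldXD mulrDr.
Qed.

Let act0r b p : act b p 0 = 0.
Proof. by apply: (addrI (act b p 0)); rewrite -actDr !addr0. Qed.

Let actZ b a p c : act b (a *: p) c = a * act b p c.
Proof.
elim/skew_ind: p => [|p q IHp IHq|d m]; first by rewrite scaler0 act0l mulr0.
  by rewrite scalerDr !actDl IHp IHq mulrDr.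
by rewrite scalerA !actU mulrA.
Qed.

Let actX b i p c : act b (skewXmul i p) c = Xact b i (act b p c).
Proof.
elim/skew_ind: p => [|p q IHp IHq|a m].
- rewrite skewXmul0 act0l; apply: (addrI (Xact b i 0)).
  by rewrite -XactD !addr0.
- by rewrite skewXmulD !actDl IHp IHq XactD.
rewrite skewXmulZU !actU XactM actDl actU; congr (_ + _).
rewrite (big_morph (act b ^~ c) (fun _ _ => actDl _ _ _ _) (act0l b c)).
by apply: eq_bigr => j _; rewrite actU.
Qed.

Let actM b p q c : act b (p * q) c = act b p (act b q c).
Proof.
elim/skew_ind: p => [|p p' IHp IHp'|a m].
- by rewrite mul0r !act0l.
- by rewrite mulrDl !actDl IHp IHp'.
rewrite actU -scalerAl actZ; congr (_ * _).
elim: m => [|i m IHm]; first by rewrite mul1r.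
by rewrite -[i :: m]cat1s -skewmonoM -mulrA skewXM actX IHm.
Qed.

Let actC b a c : act b (a%:A : T) c = a * c.
Proof. exact: (actU b a [::] c). Qed.

Let actx b i c : act b (skewX hdelta i) c = Xact b i c.
Proof. by have := actU b 1 [:: i] c; rewrite scale1r mul1r. Qed.

Let act_ideal b p : point_ideal b p -> act b p 1 = 0.
Proof.
move=> [q ->]; rewrite (big_morph (act b ^~ 1) (fun _ _ => actDl _ _ _ _) (act0l b 1)).
apply: big1 => i _; rewrite actM.
suff -> : act b (skewX hdelta i - (b i 0)%:A) 1 = 0 by exact: act0r.
rewrite actDl -scaleNr actC actx mulr1.
rewrite /Xact (delta1 hdelta) addr0 (bigD1 i) //= sigma1 eqxx mul1r.
rewrite big1 ?addr0 ?subrr // => j ji.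
by rewrite sigma1 eq_sym (negPf ji) mul0r.
Qed.

Lemma skew_eval_uniq b (p : T) c d :
  point_ideal b (p - c%:A) -> point_ideal b (p - d%:A) -> c = d.
Proof.
have E e : point_ideal b (p - e%:A) -> act b p 1 = e.
  move/act_ideal; rewrite actDl -scaleNr actC mulr1.
  by move/eqP; rewrite subr_eq0 => /eqP.
by move=> /E <- /E <-.
Qed.

Lemma skew_evalP b p : point_ideal b (p - (skew_eval b p)%:A).
Proof. exact: (xgetPex 0 (skew_eval_ex b p)). Qed.

Lemma skew_evalE b p c : point_ideal b (p - c%:A) -> skew_eval b p = c.
Proof. exact: skew_eval_uniq (skew_evalP b p). Qed.

End Evaluation.


Section Linearized.
Variables (F : unitRingType) (n : nat) (sigma : F -> 'M[F]_n).
Variable (delta : F -> 'cV[F]_n).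

Definition linop (a : 'cV[F]_n) (beta : F) : 'cV[F]_n :=
  sigma beta *m a + delta beta.

Fixpoint linop_mono (a : 'cV[F]_n) (m : monomial n) (beta : F) : F :=
  if m is i :: m' then linop a (linop_mono a m' beta) i 0 else beta.

Definition conj_point (a : 'cV[F]_n) (beta : F) : 'cV[F]_n :=
  rscale_col (linop a beta) beta^-1.

Definition conjugate_points (a b : 'cV[F]_n) : Prop :=
  exists2 beta : F, beta != 0 & b = conj_point a beta.

Definition centralizer_pt (a : 'cV[F]_n) : {pred F} :=
  [pred beta | linop a beta == rscale_col a beta].

(* Columns are ordered lexicographically in (i, j). *)
Definition lin_vandermonde (N : seq (monomial n)) l (a : 'I_l -> 'cV[F]_n)
    (M : 'I_l -> nat) (beta : forall i, 'I_(M i) -> F) :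
    'M[F]_(size N, \sum_i M i) :=
  \mxrow_(i < l) \matrix_(r < size N, j < M i)
    linop_mono (a i) (tnth (in_tuple N) r) (beta i j).

End Linearized.

Definition skew_vandermonde (F : nzRingType) n
    (sigma : {rmorphism F -> 'M[F]_n}) (delta : F -> 'cV[F]_n)
    (hdelta : sigma_derivation sigma delta) (N : seq (monomial n))
    m (b : 'I_m -> 'cV[F]_n) : 'M[F]_(size N, m) :=
  \matrix_(r < size N, s < m)
    skew_eval (b s) (skewmono hdelta (tnth (in_tuple N) r)).

(* Main.v *)
(** Since N_m(a^beta) * beta = D_a^m(beta), the linearized matrix is the skew one
    with its columns rescaled, and the rank only depends on the left kernel.
    The maps D_a^m are right K_a-linear, so the beta's may be replaced by
    K_a-bases of their spans without changing the left kernel.  Let x_i act on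
    rows by v |-> (D_(a_s)(v_s)_i)_s.  The span of the rows of degree < d can
    grow only while d is at most the number of distinct columns, so the rows
    indexed by N span a left subspace stable under all x_i.  As in Jacobson's
    density theorem, such a stable subspace is the whole space: otherwise a
    coordinate is a combination of others with coefficients g_s satisfying
    D_a(g_s) = a_s g_s, and non-conjugacy together with freeness of the bases
    excludes this.  The rank is thus the total number of basis elements. *)

Require Import Defs.
From mathcomp Require Import all_boot all_order all_algebra.
From mathcomp Require Import boolp classical_sets.

Set Implicit Arguments.
Unset Strict Implicit.
Unset Printing Implicit Defensive.

Import GRing.Theory.
Local Open Scope ring_scope.

(** The type of [sig2 (Rank i j)] depends on [sig1 (Rank i j)], so equating it with [j] needs a
    cast; composing with a family valued in a fixed type avoids this. *)
Lemma tagnat_famK l (p : 'I_l -> nat) (T : Type) (f : forall i, 'I_(p i) -> T)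
    i (j : 'I_(p i)) :
  f (tagnat.sig1 (tagnat.Rank i j)) (tagnat.sig2 (tagnat.Rank i j)) = f i j.
Proof. by rewrite /tagnat.sig1 /tagnat.sig2 /tagnat.Rank tagnat.rankK. Qed.

Lemma tagnat_sum (V : nmodType) l (p : 'I_l -> nat) (f : 'I_(\sum_i p i) -> V) :
  \sum_s f s = \sum_i \sum_j f (tagnat.Rank i j).
Proof.
rewrite sig_big_dep (reindex _ tagnat.sig_bij_on) /=.
by apply: eq_bigr => s _; rewrite tagnat.sig2K.
Qed.

(** * Left subspaces and spans *)

Section LeftSpans.
Variables (R : nzRingType) (V : lmodType R).

Definition left_subspace (W : set V) : Prop :=
  W 0 /\ forall c x y, W x -> W y -> W (c *: x + y).

Variable W : set V.
Hypothesis subW : left_subspace W.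

Lemma left_subspaceZ c x : W x -> W (c *: x).
Proof. by case: subW => W0 WL Wx; rewrite -[_ *: _]addr0; apply: WL. Qed.

Lemma left_subspaceD x y : W x -> W y -> W (x + y).
Proof. by case: subW => _ WL Wx Wy; rewrite -[x]scale1r; apply: WL. Qed.

Lemma left_subspaceB x y : W x -> W y -> W (x - y).
Proof.
by case: subW => _ WL Wx Wy; rewrite addrC -scaleN1r; apply: WL.
Qed.

Lemma left_subspace_sum (I : Type) (r : seq I) (f : I -> V) :
  (forall i, W (f i)) -> W (\sum_(i <- r) f i).
Proof.
move=> Wf; elim/big_ind: _ => // [|x y]; [by case: subW|exact: left_subspaceD].
Qed.

Lemma lspan_sub_subspace m (v : 'I_m -> V) :
  (forall j, W (v j)) -> forall x, lspan predT v x -> W x.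
Proof.
move=> Wv x [c _ ->]; apply: left_subspace_sum => j.
exact: left_subspaceZ.
Qed.
End LeftSpans.

Lemma lspan_subspace (R : nzRingType) (V : lmodType R) m (v : 'I_m -> V) :
  left_subspace (lspan predT v).
Proof.
split=> [|c x y [d _ ->] [e _ ->]].
  by exists (fun=> 0) => //; rewrite big1 // => j _; rewrite scale0r.
exists (fun j => c * d j + e j) => //.
rewrite scaler_sumr -big_split; apply: eq_bigr => j _.
by rewrite scalerDl scalerA.
Qed.

Lemma lspan_gen (R : nzRingType) (V : lmodType R) m (v : 'I_m -> V) j :
  lspan predT v (v j).
Proof.
exists (fun k => (k == j)%:R) => //.
rewrite (bigD1 j) //= eqxx scale1r big1 ?addr0 // => k /negPf->.
by rewrite scale0r.
Qed.

Lemma lspan_rowE (R : nzRingType) m n (A : 'M[R]_(m, n)) :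
  lspan predT (fun i => row i A) = [set u | exists x : 'rV_m, u = x *m A]%classic.
Proof.
rewrite eqEsubset; split=> u [x].
  move=> _ ->; exists (\row_i x i); rewrite mulmx_sum_row.
  by apply: eq_bigr => i _; rewrite mxE.
by move=> ->; exists (fun i => x 0 i) => //; rewrite mulmx_sum_row.
Qed.

(** * Rank over a division ring *)

Section DivisionRing.
Variable F : unitRingType.
Hypothesis hF : forall x : F, x != 0 -> x \is a GRing.unit.

Let T : {pred F} := predT.
Let TD : divring_closed T. Proof. by []. Qed.
Let TU x : x \in T -> x != 0 -> x \is a GRing.unit. Proof. by move=> _ /hF. Qed.

Lemma mxrkP m n (A : 'M[F]_(m, n)) :
  is_ldim predT (lspan predT (fun i => row i A)) (mxrk A).
Proof. exact: (ldim_lspanP TD TU). Qed.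

(** The row space is the space of coefficient vectors modulo the left kernel. Lifting a basis of the
    row space of A to vectors [x i] makes the [x i *m B] a basis of the row space of B. *)
Lemma mxrk_eq_lker m n n' (A : 'M[F]_(m, n)) (B : 'M[F]_(m, n')) :
  (forall c : 'rV_m, c *m A = 0 <-> c *m B = 0) -> mxrk A = mxrk B.
Proof.
move=> AB; have [e fe eA] := mxrkP A; symmetry.
have /choice[x xP] : forall i, exists x : 'rV_m, e i = x *m A.
  move=> i; have := lspan_gen e i; rewrite eA lspan_rowE.
  by case=> x ->; exists x.
have sumE n'' (C : 'M_(m, n'')) (c : 'I_(mxrk A) -> F) :
    \sum_i c i *: (x i *m C) = (\sum_i c i *: x i) *m C.
  by rewrite mulmx_suml; apply: eq_bigr => i _; rewrite scalemxAl.
apply: (ldimE TD TU); exists (fun i => x i *m B) => [c _|].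
  rewrite sumE => /AB; rewrite -sumE => cA; apply: fe => //.
  by rewrite -[RHS]cA; apply: eq_bigr => i _; rewrite xP.
rewrite lspan_rowE eqEsubset; split=> u.
  by case=> c _ ->; rewrite sumE; eexists.
case=> y ->; have : lspan predT e (y *m A) by rewrite eA lspan_rowE; exists y.
(* The difference of [y] and [\sum_i c i *: x i] lies in the left kernel of A, hence in that of
   B. *)
case=> c _ yA; exists c => //; rewrite sumE; apply/eqP; rewrite -subr_eq0 -mulmxBl.
apply/eqP/AB; rewrite mulmxBl -sumE yA; apply/eqP; rewrite subr_eq0; apply/eqP.
by apply: eq_bigr => i _; rewrite xP.
Qed.

Lemma mxrk_row_full m n (A : 'M[F]_(m, n)) :
  (forall u, lspan predT (fun i => row i A) u) -> mxrk A = n.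
Proof.
move=> A1; apply: (ldimE TD TU); exists (fun i => delta_mx 0 i) => [c _|].
  move=> c0 j; have /rowP/(_ j) := c0.
  rewrite summxE !mxE (bigD1 j) //= !mxE !eqxx mulr1 big1 ?addr0 // => i ij.
  by rewrite !mxE eq_sym (negPf ij) mulr0.
rewrite eqEsubset; split=> u // _; exists (fun i => u 0 i) => //.
exact: row_sum_delta.
Qed.

(* A linear dependence would express the last vector with nonzero coefficient
   through the previous ones. *)
Lemma lfree_chain (V : lmodType F) (U : nat -> set V) m (v : 'I_m -> V) :
  (forall d, left_subspace (U d)) ->
  (forall i j : 'I_m, (i < j)%N -> U j (v i)) ->
  (forall i : 'I_m, ~ U i (v i)) -> lfree predT v.
Proof.
move=> sU Uv nUv c _ cv0 j; apply/eqP; apply: contraT => cj.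
pose i := [arg max_(i > j | c i != 0) (i : nat)].
have [ci maxi] : c i != 0 /\ forall k : 'I_m, c k != 0 -> (k <= i)%N.
  by rewrite /i; case: arg_maxnP.
case: (nUv i); have Uci : U i (c i *: v i).
  move: cv0; rewrite (bigD1 i) //= => /eqP; rewrite addr_eq0 => /eqP->.
  rewrite -scaleN1r; apply: left_subspaceZ => //.
  rewrite big_mkcond; apply: left_subspace_sum => // k.
  case: ifP => [ki|_]; last by case: (sU i).
  have [->|ck] := eqVneq (c k) 0; first by rewrite scale0r; case: (sU i).
  apply: left_subspaceZ => //; apply: Uv.
  by rewrite ltn_neqAle maxi // andbT.
by rewrite -[v i]scale1r -(mulVr (hF ci)) -scalerA; apply: left_subspaceZ.
Qed.
End DivisionRing.

(** Modulo the left ideal generated by the X_j - b_j, p is congruent to c, hence y p to y c, where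
    each X_j may be replaced by b_j. This is the passage from a monomial m to x_i m in
    [skew_eval_mono]. *)
Lemma lalg_left_ideal_mul (R : nzRingType) (A : lalgType R) n
    (X q : 'I_n -> A) (b s : 'I_n -> R) (p y : A) (c d : R) :
  p - c%:A = \sum_j q j * (X j - (b j)%:A) ->
  y * c%:A = \sum_j s j *: X j + d%:A ->
  y * p - (\sum_j s j * b j + d)%:A =
    \sum_j (y * q j + (s j)%:A) * (X j - (b j)%:A).
Proof.
move=> pc yc.
under [RHS]eq_bigr do rewrite mulrDl -mulrA -scalerAl mul1r scalerBr scalerA.
rewrite big_split -mulr_sumr -pc mulrBr yc sumrB /= scalerDl scaler_suml.
rewrite -[RHS]addrA; congr (_ + _).
by rewrite !opprD [RHS]addrC addrACA subrr add0r.
Qed.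

(** * The operators D_a, their iterates and the centralizers K_a *)

Section Linop.
Variables (F : unitRingType) (n : nat) (sigma : {rmorphism F -> 'M[F]_n}).
Variables (delta : F -> 'cV[F]_n) (hdelta : sigma_derivation sigma delta).
Hypothesis hF : forall x : F, x != 0 -> x \is a GRing.unit.

Local Notation D := (linop sigma delta).
Local Notation Dm := (linop_mono sigma delta).
Local Notation K := (centralizer_pt sigma delta).

Lemma linopD a : {morph D a : x y / x + y}.
Proof.
by move=> x y; rewrite /linop rmorphD mulmxDl hdelta.1 addrACA.
Qed.

Lemma linop0 a : D a 0 = 0.
Proof. by apply: (addrI (D a 0)); rewrite -linopD !addr0. Qed.

Lemma linopN a x : D a (- x) = - D a x.
Proof. by apply/eqP; rewrite -addr_eq0 -linopD addNr linop0. Qed.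

(** Multiplicativity of [sigma] combined with the twisted Leibniz rule. Change of base point and
    right K_a-linearity both follow by substituting the value of D_a(x). *)
Lemma linopM a c x i : D a (c * x) i 0 =
  \sum_j sigma c i j * D a x j 0 + delta c i 0 * x.
Proof.
rewrite !mxE (deltaM hdelta) addrA; congr (_ + _).
under [RHS]eq_bigr => j _ do rewrite !mxE mulrDr mulr_sumr.
rewrite big_split exchange_big /=; congr (_ + _).
apply: eq_bigr => j _; rewrite sigmaM mulr_suml.
by apply: eq_bigr => k _; rewrite mulrA.
Qed.

Lemma linop1 a : D a 1 = a.
Proof.
rewrite /linop rmorph1 mul1mx; apply/colP => i.
by rewrite mxE (delta1 hdelta) addr0.
Qed.

Lemma linop_conj a x c : x != 0 ->
  D a (c * x) = rscale_col (D (conj_point sigma delta a x) c) x.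
Proof.
move=> x0; apply/colP => i; rewrite linopM !mxE mulrDl; congr (_ + _).
rewrite mulr_suml; apply: eq_bigr => j _.
by rewrite !mxE -!mulrA mulVr ?mulr1 ?hF.
Qed.

Lemma linop_mono_conj a x c m : x != 0 ->
  Dm a m (c * x) = Dm (conj_point sigma delta a x) m c * x.
Proof. by move=> x0; elim: m => //= i m ->; rewrite linop_conj ?mxE. Qed.

Lemma centralizer_ptP a x : reflect (D a x = rscale_col a x) (x \in K a).
Proof. exact: eqP. Qed.

Lemma linop_centralizer a c x :
  x \in K a -> D a (c * x) = rscale_col (D a c) x.
Proof.
move=> /centralizer_ptP Dx; apply/colP => i; rewrite linopM Dx !mxE mulrDl.
by congr (_ + _); rewrite mulr_suml; apply: eq_bigr => j _; rewrite !mxE mulrA.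
Qed.

Lemma linop_monoD a m : {morph Dm a m : x y / x + y}.
Proof. by elim: m => //= i m IHm x y; rewrite IHm linopD mxE. Qed.

Lemma linop_mono_centralizer a m c x :
  x \in K a -> Dm a m (c * x) = Dm a m c * x.
Proof.
by move=> Kx; elim: m => //= i m ->; rewrite linop_centralizer ?mxE.
Qed.

Lemma rscale_colA (v : 'cV[F]_n) c d :
  rscale_col (rscale_col v c) d = rscale_col v (c * d).
Proof. by apply/colP => i; rewrite !mxE mulrA. Qed.

Lemma rscale_col1 (v : 'cV[F]_n) : rscale_col v 1 = v.
Proof. by apply/colP => i; rewrite !mxE mulr1. Qed.

(** By right K_a-linearity, D_a(x^-1) x = D_a(x^-1 x) = D_a(1) = a. *)
Lemma centralizer_ptV a x : x \in K a -> x^-1 \in K a.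
Proof.
have [->|x0] := eqVneq x 0; first by rewrite invr0.
move=> Kx; apply/centralizer_ptP; rewrite -[LHS]rscale_col1 -(mulrV (hF x0)).
by rewrite -rscale_colA -linop_centralizer // mulVr ?hF // linop1.
Qed.

Lemma centralizer_pt_divring a :
  @divring_closed F^c (K a : {pred F^c}).
Proof.
split=> [|x y /centralizer_ptP Dx /centralizer_ptP Dy|x y Kx Ky].
- by apply/centralizer_ptP; rewrite linop1 rscale_col1.
- apply/centralizer_ptP; rewrite linopD linopN Dx Dy.
  by apply/colP => i; rewrite !mxE mulrBr.
(* Products are reversed in [F^c], so x / y there is y^-1 x in F. *)
apply/centralizer_ptP; rewrite -[_ / _]/((y : F)^-1 * (x : F)).
rewrite linop_centralizer // (centralizer_ptP _ _ (centralizer_ptV Ky)).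
by rewrite rscale_colA.
Qed.

Lemma rdim_basis a m (v : 'I_m -> F) :
  exists2 e : 'I_(rdim (K a) (rspan (K a) v)) -> F,
    @lfree F^c (F^c)^o (K a) _ e & rspan (K a) e = rspan (K a) v.
Proof.
have KU (x : F^c) : x \in (K a : {pred F^c}) -> x != 0 -> x \is a GRing.unit.
  by move=> _ /hF.
have := @ldim_lspanP F^c (F^c)^o (K a) (centralizer_pt_divring a) KU m v.
by case=> e fe ee; exists e.
Qed.

Lemma rspan_mem a m (v : 'I_m -> F) j : rspan (K a) v (v j).
Proof. exact: (@lspan_mem F^c (F^c)^o (K a) (centralizer_pt_divring a)). Qed.

Section Comb.
Variables (a : 'cV[F]_n) (I : Type) (r : seq I) (c : I -> F)
  (mm : I -> seq 'I_n).
Let L x := \sum_(i <- r) c i * Dm a (mm i) x.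

(* A left combination of the maps D_a^m is right K_a-linear. *)
Lemma linop_comb_rspan m (v : 'I_m -> F) :
  (forall j, L (v j) = 0) -> forall x, rspan (K a) v x -> L x = 0.
Proof.
have LD : {morph L : x y / x + y}.
  move=> x y; rewrite -big_split; apply: eq_bigr => i _.
  by rewrite linop_monoD mulrDr.
have L0 : L 0 = 0 by apply: (addrI (L 0)); rewrite -LD !addr0.
move=> Lv x; rewrite rspanE => -[d Kd ->].
rewrite (big_morph L LD L0) big1 // => j _.
rewrite /L; under eq_bigr => i _ do
  rewrite linop_mono_centralizer ?Kd // mulrA.
by rewrite -mulr_suml -/(L _) Lv mul0r.
Qed.
End Comb.

(** Skew evaluation obeys the recursion of the iterates of D_b started at 1: if m evaluates to c at
    b, then x_i m evaluates to the i-th entry of D_b(c). *)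
Lemma skew_eval_mono b m :
  skew_eval b (skewmono hdelta m) = Dm b m 1.
Proof.
elim: m => [|i m IHm] /=; apply: skew_evalE.
  by exists (fun=> 0); rewrite big1 => [|i _]; rewrite ?mul0r // scale1r subrr.
have [q qP] := skew_evalP b (skewmono hdelta m); rewrite IHm in qP.
have := lalg_left_ideal_mul qP (skewXC hdelta i _).
rewrite skewmonoM cat1s => E.
exists (fun j => skewX hdelta i * q j + (sigma (Dm b m 1) i j)%:A).
by rewrite !mxE.
Qed.

(** * Monomial rows and the action of the variables on rows *)

Section Rows.
Variables (r : nat) (alpha : 'I_r -> 'cV[F]_n).

Definition row_op (i : 'I_n) (v : 'rV[F]_r) : 'rV[F]_r :=
  \row_s D (alpha s) (v 0 s) i 0.

Lemma row_opE i v s : row_op i v 0 s = D (alpha s) (v 0 s) i 0.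
Proof. by rewrite mxE. Qed.

Lemma row_opD i : {morph row_op i : u v / u + v}.
Proof. move=> u v; apply/rowP => s.
by rewrite row_opE [(u + v) 0 s]mxE linopD mxE [RHS]mxE !row_opE. Qed.

Lemma row_opZ i c v : row_op i (c *: v) =
  \sum_j sigma c i j *: row_op j v + delta c i 0 *: v.
Proof.
apply/rowP => s; rewrite row_opE [(c *: v) 0 s]mxE linopM [RHS]mxE summxE.
by congr (_ + _); [apply: eq_bigr => j _|]; rewrite [RHS]mxE ?row_opE.
Qed.

Definition row_stable (W : set 'rV[F]_r) : Prop :=
  left_subspace W /\ forall i v, W v -> W (row_op i v).

(** The operator [row_op i] need not be left linear, but it sends c v to a left combination of v and
    all the [row_op j v], so stability can be tested on generators, for all variables at once. *)
Lemma lspan_row_stable m (v : 'I_m -> 'rV[F]_r) :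
  (forall i j, lspan predT v (row_op i (v j))) -> row_stable (lspan predT v).
Proof.
move=> Wv; split=> [|i u [c _ ->]]; first exact: lspan_subspace.
have row_op0 : row_op i 0 = 0.
  by apply: (addrI (row_op i 0)); rewrite -row_opD !addr0.
have sW := lspan_subspace v.
rewrite (big_morph _ (row_opD i) row_op0); apply: left_subspace_sum => // j.
rewrite row_opZ; apply: left_subspaceD => //.
  apply: left_subspace_sum => // k; exact: left_subspaceZ.
by apply: left_subspaceZ => //; apply: lspan_gen.
Qed.

Variable e : 'I_r -> F.

Definition mono_row (m : seq 'I_n) : 'rV[F]_r :=
  \row_s Dm (alpha s) m (e s).

Lemma mono_rowE m s : mono_row m 0 s = Dm (alpha s) m (e s).
Proof. by rewrite mxE. Qed.

Lemma mono_row_cons i m : mono_row (i :: m) = row_op i (mono_row m).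
Proof. by apply/rowP => s; rewrite row_opE !mono_rowE. Qed.

Lemma mono_row_stable (W : set 'rV[F]_r) :
  row_stable W -> W (mono_row [::]) -> forall m, W (mono_row m).
Proof.
by move=> [_ WX] W1; elim=> [//|i m IHm]; rewrite mono_row_cons; apply: WX.
Qed.

Lemma lspan_mono_row (N : seq (seq 'I_n)) m : m \in N ->
  lspan predT (fun k => mono_row (tnth (in_tuple N) k)) (mono_row m).
Proof.
move=> /(tnthP (in_tuple N))[k ->].
exact: (lspan_gen (fun k => mono_row (tnth (in_tuple N) k))).
Qed.

(* Let U d be the span of the rows of degree < d.  If U d = U d.+1 then U d
   contains all rows; if this fails for all d <= p, there are p.+1 independent
   rows in the span of u. *)
Lemma mono_row_lspan (N : seq (seq 'I_n)) p (u : 'I_p -> 'rV[F]_r) :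
  (forall m, (size m < p)%N -> m \in N) ->
  (forall m, lspan predT u (mono_row m)) ->
  forall m, lspan predT (fun k => mono_row (tnth (in_tuple N) k)) (mono_row m).
Proof.
move=> pN uM.
pose N_ d := [seq m <- N | (size m < d)%N].
pose U d : set 'rV[F]_r :=
  lspan predT (fun k => mono_row (tnth (in_tuple (N_ d)) k)).
(* For d <= p every monomial of degree below d lies in N, so [N_ d] lists all of them. *)
have Um d m : (d <= p)%N -> (size m < d)%N -> U d (mono_row m).
  move=> dp md; apply: lspan_mono_row.
  by rewrite mem_filter md pN // (leq_trans md).
have [[d dp Ud]|noU] := pselect (exists2 d, (d <= p)%N &
    forall m, size m = d -> U d (mono_row m)).
  have UmS m : (size m <= d)%N -> U d (mono_row m).
    by rewrite leq_eqVlt => /orP[/eqP|]; [exact: Ud|exact: Um].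
  have UX : row_stable (U d).
    apply: lspan_row_stable => i k; rewrite -mono_row_cons; apply: UmS.
    by have := mem_tnth k (in_tuple (N_ d)); rewrite mem_filter => /andP[].
  move=> m; have := mono_row_stable UX (UmS [::] isT) m.
  apply: (lspan_sub_subspace (lspan_subspace _)) => k.
  apply: lspan_mono_row; have := mem_tnth k (in_tuple (N_ d)).
  by rewrite mem_filter => /andP[].
have /choice[f fP] : forall d : 'I_p.+1, exists m,
    size m = d /\ ~ U d (mono_row m).
  move=> d; apply: contrapT => nm; apply: noU; exists d => [|m md].
    by rewrite -ltnS.
  by apply: contrapT => Um'; apply: nm; exists m.
have fm : lfree predT (fun d => mono_row (f d)).
  apply: (lfree_chain hF (U := U)) => [d|i j ij|i].
  - exact: lspan_subspace.
  - by apply: Um; rewrite ?(fP i).1 // -ltnS.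
  - exact: (fP i).2.
have predTU (x : F) : x \in predT -> x != 0 -> x \is a GRing.unit.
  by move=> _ /hF.
suff : (p.+1 <= p)%N by rewrite ltnn.
by apply: (lfree_leq _ predTU fm (v := u)).
Qed.
End Rows.

(** Induction on the number of coordinates: the projection forgetting coordinate 0 maps W onto the
    whole space. If W were proper, a linear relation on W with coefficient 1 at coordinate 0 would
    contradict the last hypothesis. *)
Lemma row_stable_full r (alpha : 'I_r -> 'cV[F]_n) (e : 'I_r -> F)
    (W : set 'rV[F]_r) : row_stable alpha W -> W (\row_s e s) ->
  (forall s0 g, (forall s, D (alpha s0) (g s) = rscale_col (alpha s) (g s)) ->
     \sum_s e s * g s = 0 -> g s0 = 0) ->
  forall u, W u.
Proof.
elim: r => [|r IHr] in alpha e W *.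
  by move=> [[W0 _] _] _ _ u; rewrite [u]thinmx0.
move=> [sW WX] We indep.
pose pr := @col' F 1 r.+1 ord0.
pose W' : set 'rV[F]_r := [set pr v | v in W]%classic.
have /choice[f fP] : forall u', exists v, W v /\ pr v = u'.
  suff W'1 u' : W' u' by move=> u'; case: (W'1 u') => v Wv <-; exists v.
  apply: (IHr (alpha \o lift ord0) (e \o lift ord0)).
  - split; first split=> [|c _ _ [x Wx <-] [y Wy <-]].
    + by exists 0; [case: sW|rewrite /pr linear0].
    + by exists (c *: x + y); [case: sW => _; apply|rewrite /pr linearP].
    + move=> i _ [v Wv <-]; exists (row_op alpha i v); first exact: WX.
      by apply/rowP => s; rewrite !mxE.
  - by exists (\row_s e s) => //; apply/rowP => s; rewrite !mxE.
  (* A solution on the remaining coordinates extends by 0, as D(0) = 0, so the hypothesis passes to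
     the projection. *)
  move=> s0 g Dg eg; pose h s := if unlift ord0 s is Some t then g t else 0.
  have hl t : h (lift ord0 t) = g t by rewrite /h liftK.
  have h0 : h ord0 = 0 by rewrite /h unlift_none.
  rewrite -hl; apply: indep => [s|].
    have [t ->|->] := unliftP ord0 s; first by rewrite hl; apply: Dg.
    by rewrite h0 linop0; apply/colP => i; rewrite !mxE mulr0.
  rewrite big_ord_recl h0 mulr0 add0r -[RHS]eg.
  by apply: eq_bigr => t _; rewrite hl.
(* Either W has a nonzero vector supported at coordinate 0, and is full, or coordinate 0 is
   determined on W by the others. *)
have [[z Wz [prz z0]]|noz] :=
    pselect (exists2 z, W z & pr z = 0 /\ z 0 ord0 != 0).
  move=> u; have [Wv vu] := fP (pr u); set v := f _ in Wv vu.
  suff -> : u = ((u 0 ord0 - v 0 ord0) * (z 0 ord0)^-1) *: z + v.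
    by case: sW => _; apply.
  apply/rowP => s; have [t ->|->] := unliftP ord0 s; last first.
    by rewrite !mxE mulrVK ?hF // subrK.
  have /rowP/(_ t) := vu; have /rowP/(_ t) := prz; rewrite !mxE => -> ->.
  by rewrite mulr0 add0r.
have {noz}W0 v : W v -> pr v = 0 -> v 0 ord0 = 0.
  by move=> Wv prv; apply/eqP/negPn/negP => v0; apply: noz; exists v.
pose w s := f (delta_mx 0 s).
have Ww s : W (w s) by case: (fP (delta_mx 0 s)).
have wl s t : w s 0 (lift ord0 t) = (t == s)%:R.
  by have /rowP/(_ t) := (fP (delta_mx 0 s)).2; rewrite !mxE.
(* On W, coordinate 0 is the sum of the v_t times [w t 0 ord0]; [g] holds the coefficients of this
   relation, moved to one side. *)
pose g s := if unlift ord0 s is Some t then - w t 0 ord0 else 1.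
have gl t : g (lift ord0 t) = - w t 0 ord0 by rewrite /g liftK.
have g0 : g ord0 = 1 by rewrite /g unlift_none.
have Wg v : W v -> \sum_s v 0 s * g s = 0.
  move=> Wv; pose v' := v - \sum_t v 0 (lift ord0 t) *: w t.
  have : v' 0 ord0 = 0.
    apply: W0; first apply: left_subspaceB => //.
      by apply: left_subspace_sum => // t; apply: left_subspaceZ.
    apply/rowP => t; rewrite !mxE summxE (bigD1 t) //= mxE wl eqxx mulr1.
    rewrite big1 ?addr0 ?subrr // => k kt.
    by rewrite mxE wl eq_sym (negPf kt) mulr0.
  rewrite !mxE summxE big_ord_recl g0 mulr1 -sumrN => v0; rewrite -[RHS]v0.
  by congr (_ + _); apply: eq_bigr => t _; rewrite gl mxE mulrN.
suff /eqP : g ord0 = 0 by rewrite g0 oner_eq0.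
apply: indep; last first.
  by rewrite -[RHS](Wg _ We); apply: eq_bigr => s _; rewrite mxE.
move=> s; have [t ->|->] := unliftP ord0 s; last first.
  by rewrite g0 linop1 rscale_col1.
rewrite gl linopN; apply/colP => i.
(* Off coordinate 0, [w t] is a unit vector; since D_alpha(1) = alpha and D_alpha(0) = 0, the
   difference vanishes there. It lies in W, so it vanishes at coordinate 0 too, which is the
   equation for g_t. *)
have : (row_op alpha i (w t) - alpha (lift ord0 t) i 0 *: w t) 0 ord0 = 0.
  apply: W0; first by apply: left_subspaceB; [|apply: WX|apply: left_subspaceZ].
  apply/rowP => k; rewrite mxE mxE row_opE [X in _ + X]mxE [X in - X]mxE.
  rewrite [RHS]mxE wl; have [->|kt] := eqVneq k t.
    by rewrite linop1 mulr1 subrr.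
  by rewrite linop0 mxE mulr0 subrr.
rewrite mxE row_opE [X in _ + X]mxE [X in - X]mxE => /subr0_eq E.
by rewrite mxE E [RHS]mxE mulrN.
Qed.

(** * Columns grouped by conjugacy class *)

Section Families.
Variables (l : nat) (a : 'I_l -> 'cV[F]_n).

Definition col_point (M : 'I_l -> nat) (s : 'I_(\sum_i M i)) := a (tagnat.sig1 s).
Definition col_elt (M : 'I_l -> nat) (e : forall i, 'I_(M i) -> F)
  (s : 'I_(\sum_i M i)) := e (tagnat.sig1 s) (tagnat.sig2 s).

Lemma row_lin_vandermonde N (M : 'I_l -> nat) (e : forall i, 'I_(M i) -> F) k :
  row k (lin_vandermonde sigma delta N a e) =
  mono_row (@col_point M) (col_elt e) (tnth (in_tuple N) k).
Proof. by apply/rowP => s; rewrite mxE mxE mono_rowE mxE. Qed.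

Lemma lin_vandermonde_ker N (M : 'I_l -> nat) (e : forall i, 'I_(M i) -> F)
    (c : 'rV_(size N)) :
  c *m lin_vandermonde sigma delta N a e = 0 <->
  forall i j, \sum_k c 0 k * Dm (a i) (tnth (in_tuple N) k) (e i j) = 0.
Proof.
have E s : (c *m lin_vandermonde sigma delta N a e) 0 s =
    \sum_k c 0 k * Dm (a (tagnat.sig1 s)) (tnth (in_tuple N) k) (col_elt e s).
  by rewrite mxE; apply: eq_bigr => k _; rewrite mxE mxE.
split=> [/rowP c0 i j|c0].
  have := c0 (tagnat.Rank i j); rewrite E mxE; apply: etrans.
  by rewrite -[LHS](tagnat_famK (fun i j =>
    \sum_k c 0 k * Dm (a i) (tnth (in_tuple N) k) (e i j))).
by apply/rowP => s; rewrite E mxE; apply: c0.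
Qed.

Hypothesis ha : forall i j : 'I_l, i != j ->
  ~ conjugate_points sigma delta (a i) (a j).

(** A nonzero g_s makes the point of column s the conjugate by g_s of the point of s0, so both
    columns are in one block. Within this block every g_s lies in K_a, and freeness over K_a forces
    it to be 0. *)
Lemma col_independent (r : 'I_l -> nat) (e : forall i, 'I_(r i) -> F) :
  (forall i, @lfree F^c (F^c)^o (K (a i)) _ (e i)) ->
  forall s0 g,
  (forall s, D (@col_point r s0) (g s) = rscale_col (@col_point r s) (g s)) ->
  \sum_s col_elt e s * g s = 0 -> g s0 = 0.
Proof.
move=> fe s0 g Dg eg; pose i0 := tagnat.sig1 s0.
have g0 s : tagnat.sig1 s != i0 -> g s = 0.
  move=> si; apply/eqP; apply: contraT => gs; case: (@ha i0 (tagnat.sig1 s)).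
    by rewrite eq_sym.
  exists (g s) => //; rewrite /conj_point -/(col_point s0) Dg rscale_colA.
  by rewrite mulrV ?hF // rscale_col1.
have <- : g (tagnat.Rank i0 (tagnat.sig2 s0)) = g s0 by rewrite tagnat.sig2K.
apply: (fe i0 (fun k => g (tagnat.Rank i0 k))) => [k|].
  apply/centralizer_ptP; rewrite -/(col_point s0) Dg.
  by rewrite /col_point tagnat.Rank1K.
rewrite -[RHS]eg tagnat_sum (bigD1 i0) //= [X in _ + X]big1 ?addr0.
  apply: eq_bigr => k _; rewrite -[LHS]/(e i0 k * g (tagnat.Rank i0 k)).
  by rewrite /col_elt (tagnat_famK e).
move=> i ii0; rewrite big1 // => k _; rewrite g0 ?mulr0 //.
by rewrite tagnat.Rank1K.
Qed.
End Families.
End Linop.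

Theorem theorem10 (F : unitRingType)
    (hF : forall x : F, x != 0 -> x \is a GRing.unit)
    (n : nat) (hn : (0 < n)%N)
    (sigma : {rmorphism F -> 'M[F]_n}) (delta : F -> 'cV[F]_n)
    (hdelta : sigma_derivation sigma delta)
    (l : nat) (a : 'I_l -> 'cV[F]_n)
    (ha : forall i j : 'I_l, i != j ->
       ~ conjugate_points sigma delta (a i) (a j))
    (M : 'I_l -> nat) (beta : forall i : 'I_l, 'I_(M i) -> F)
    (hbeta : forall (i : 'I_l) (j : 'I_(M i)), beta i j != 0)
    (b : 'I_(\sum_i M i) -> 'cV[F]_n)
    (hb : forall (i : 'I_l) (j : 'I_(M i)),
       b (tagnat.Rank i j) = conj_point sigma delta (a i) (beta i j))
    (N : seq (monomial n)) (hN : uniq N)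
    (hMN : forall m : monomial n,
       (size m < size (undup (codom b)))%N -> m \in N) :
  mxrk (lin_vandermonde sigma delta N a beta)
    = mxrk (skew_vandermonde hdelta N b) /\
  mxrk (skew_vandermonde hdelta N b)
    = (\sum_(i < l) rdim (centralizer_pt sigma delta (a i))
         (rspan (centralizer_pt sigma delta (a i)) (beta i)))%N.
Proof.
have DmE s m : linop_mono sigma delta (col_point a s) m (col_elt beta s) =
    linop_mono sigma delta (b s) m 1 * col_elt beta s.
  rewrite -[s in b s]tagnat.sig2K hb -linop_mono_conj ?mul1r //; exact: hbeta.
have skewE : mxrk (lin_vandermonde sigma delta N a beta) =
    mxrk (skew_vandermonde hdelta N b).
  apply: mxrk_eq_lker => // c.
  have E s : (c *m lin_vandermonde sigma delta N a beta) 0 s =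
      (c *m skew_vandermonde hdelta N b) 0 s * col_elt beta s.
    rewrite mxE [in RHS]mxE mulr_suml; apply: eq_bigr => k _.
    by rewrite !mxE DmE skew_eval_mono mulrA.
  split=> c0; apply/rowP => s; rewrite [RHS]mxE; last by rewrite E c0 mxE mul0r.
  have Us : col_elt beta s \is a GRing.unit by apply/hF/hbeta.
  apply: (mulIr Us).
  by rewrite -[LHS]E c0 mxE mul0r.
split=> //; rewrite -skewE.
pose K i := centralizer_pt sigma delta (a i).
pose r i := rdim (K i) (rspan (K i) (beta i)).
(* The basis sizes vary with i, so the bases are chosen as a dependent family. *)
pose B i := cid2 (rdim_basis hdelta hF (a i) (beta i)).
pose e i : 'I_(r i) -> F := s2val (B i).
have fe i : @lfree F^c (F^c)^o (K i) _ (e i) := s2valP (B i).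
have ee i : rspan (K i) (e i) = rspan (K i) (beta i) := s2valP' (B i).
have eb i j : rspan (K i) (beta i) (e i j) by rewrite -ee; apply: rspan_mem.
have be i j : rspan (K i) (e i) (beta i j) by rewrite ee; apply: rspan_mem.
have -> : mxrk (lin_vandermonde sigma delta N a beta) =
    mxrk (lin_vandermonde sigma delta N a e).
  apply: mxrk_eq_lker => // c; rewrite !lin_vandermonde_ker.
  split=> c0 i j.
    exact: (linop_comb_rspan hdelta (c0 i) (eb i j)).
  exact: (linop_comb_rspan hdelta (c0 i) (be i j)).
(* One vector [u k] per distinct point: every monomial row combines them with the values of N_m at
   the points as coefficients. So |B| vectors suffice even when columns share a point. *)
pose P := undup (codom b).
pose u (k : 'I_(size P)) : 'rV_(\sum_i M i) :=
  \row_s ((b s == tnth (in_tuple P) k)%:R * col_elt beta s).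
have uP m : lspan predT u
    (mono_row sigma delta (@col_point _ _ _ a M) (col_elt beta) m).
  exists (fun k => linop_mono sigma delta (tnth (in_tuple P) k) m 1) => //.
  apply/rowP => s; rewrite summxE mono_rowE DmE.
  have /(tnthP (in_tuple P))[k bk] : b s \in P by rewrite mem_undup codom_f.
  rewrite (bigD1 k) //= [X in _ + X]big1 => [|k' kk'].
    by rewrite !mxE -bk eqxx mul1r addr0.
  rewrite !mxE bk (inj_eq (tuple_uniqP _ _)) ?undup_uniq //.
  by rewrite eq_sym (negPf kk') mul0r mulr0.
pose V := lspan predT (fun k => mono_row sigma delta (@col_point _ _ _ a r)
  (col_elt e) (tnth (in_tuple N) k)).
have VM m : V (mono_row sigma delta (@col_point _ _ _ a r) (col_elt e) m).
  (* The degree bound |B| is used on the columns of [beta]; the relation found there is then carried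
     to the bases by right K_a-linearity. *)
  have [c _ mE] := mono_row_lspan hdelta hF hMN uP m.
  exists c => //; apply/rowP => s; rewrite summxE mono_rowE.
  (* [None] stands for m itself, with coefficient -1, so that the relation becomes a single
     vanishing combination of the iterates. *)
  pose q := None :: [seq Some k | k <- index_enum 'I_(size N)].
  pose mm := oapp (tnth (in_tuple N)) m.
  have : \sum_(t <- q) oapp c (-1) t *
      linop_mono sigma delta (col_point a s) (mm t) (col_elt e s) = 0.
    apply: (linop_comb_rspan hdelta _ (eb _ _)) => j.
    set i := tagnat.sig1 s in j *.
    have /rowP/(_ (tagnat.Rank i j)) := mE.
    rewrite mono_rowE summxE big_cons big_map /col_point tagnat.Rank1K.
    rewrite /col_elt (tagnat_famK beta) => /= ->.
    rewrite mulN1r addrC; apply/eqP; rewrite subr_eq0; apply/eqP.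
    apply: eq_bigr => k _; rewrite mxE mono_rowE (tagnat_famK beta).
    by rewrite tagnat.Rank1K.
  rewrite big_cons big_map /= mulN1r addrC => /subr0_eq <-.
  by apply: eq_bigr => k _; rewrite mxE mono_rowE.
apply: mxrk_row_full => // v.
have -> : (fun k => row k (lin_vandermonde sigma delta N a e)) =
    (fun k => mono_row sigma delta (@col_point _ _ _ a r) (col_elt e)
       (tnth (in_tuple N) k)).
  by apply/funext => k; rewrite row_lin_vandermonde.
apply: (row_stable_full hdelta hF (alpha := @col_point _ _ _ a r)
  (e := col_elt e)).
- apply: lspan_row_stable => // i k; rewrite -mono_row_cons; exact: VM.
- exact: (VM [::]).
exact: col_independent.
Qed.
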